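(* Let $q>1$ and let $\zeta=\zeta(n)>0$ satisfy $\zeta=O(1)$. For the random-cluster model on the complete graph on $n$ vertices with edge probability $p=\zeta/n$ and cluster weight $q$, the mixing time $\tau_{\rm mix}^{\rm GD}$ of the Glauber dynamics and the mixing time $\tau_{\rm mix}^{\rm CM}$ of the Chayes–Machta dynamics satisfy $$\tau_{\rm mix}^{\rm GD}\le \tau_{\rm mix}^{\rm CM}\cdot O\big(n^3(\log n)^2\big).$$
   Context: The random-cluster model on a finite graph $G=(V,E)$ with parameters $p\in(0,1)$, $q>0$ is the probability measure on subsets $A\subseteq E$ given by $\mu_{G,p,q}(A)=\frac1Z p^{|A|}(1-p)^{|E|-|A|}q^{c(A)}$, where $c(A)$ is the number of connected components of $(V,A)$ and $Z$ is the normalizing constant. One step of the Chayes–Machta (CM) dynamics ($q>1$) from a configuration $A$: (i) activate each connected component of $(V,A)$ independently with probability $1/q$; (ii) remove all edges of $A$ joining two active vertices (vertices of activated components); (iii) add each edge of $G$ between two active vertices independently with probability $p$, leaving the rest unchanged. One step of the (heat-bath) Glauber dynamics from $A$: (i) pick $e\in E$ uniformly at random; (ii) move to $A\cup\{e\}$ with probability $\frac{\mu_{G,p,q}(A\cup\{e\})}{\mu_{G,p,q}(A\cup\{e\})+\mu_{G,p,q}(A\setminus\{e\})}$; (iii) otherwise move to $A\setminus\{e\}$. The mixing time of a Markov chain with transition matrix $M$ and stationary distribution $\mu$ is $\max_{X_0}\min\{t\ge0:\|M^t(X_0,\cdot)-\mu\|_{TV}\le1/4\}$. The implied constant in the claim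 depends only on $q$ and on the bound for $\zeta$. *)

(* Defs.v *)
From HB Require Import structures.
From mathcomp Require Import all_boot all_order all_algebra.
From mathcomp Require Import boolp classical_sets filter reals ereal topology exp.
Set Implicit Arguments.
Unset Strict Implicit.
Unset Printing Implicit Defensive.
Import Order.TTheory GRing.Theory Num.Theory.
Local Open Scope ring_scope.

Definition transition_matrix (R : realType) (T : finType) (P : T -> T -> R) :
    'M[R]_#|T| :=
  \matrix_(i, j) P (enum_val i) (enum_val j).

Definition law_at (R : realType) (T : finType) (P : T -> T -> R) (t : nat)
    (x y : T) : R :=
  (transition_matrix P ^+ t) (enum_rank x) (enum_rank y).

Definition tv_dist (R : realType) (T : finType) (mu nu : T -> R) : R :=
  2^-1 * \sum_(x : T) `|mu x - nu x|.

(* The minimum of the empty set of times is +oo, so that a chain which fails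
   to mix does not get a finite mixing time by convention. *)
Definition min_time (R : realType) (S : pred nat) : \bar R :=
  if pselect (exists t, S t) is left exS then (ex_minn exS)%:R%:E else +oo%E.

Definition mixing_time (R : realType) (T : finType) (P : T -> T -> R)
    (mu : T -> R) : \bar R :=
  \big[maxe/0%E]_(x : T)
    min_time R (fun t => tv_dist (law_at P t x) mu <= 4^-1).

(* A finite simple graph is given by its vertex type V and the set E of its
   edges, an edge being the two-element set of its endpoints. *)

Definition edge (V : finType) (E : {set {set V}}) : finType :=
  {e : {set V} | e \in E}.

Definition config (V : finType) (E : {set {set V}}) : finType := {set edge E}.

Definition adjacent (V : finType) (E : {set {set V}}) (A : config E) : rel V :=
  fun u v => [exists e in A, val e == [set u; v]%SET].

Definition components (V : finType) (E : {set {set V}}) (A : config E) :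
    {set {set V}} :=
  equivalence_partition (connect (adjacent A)) [set: V]%SET.

Definition rc_weight (R : realType) (V : finType) (E : {set {set V}}) (p q : R)
    (A : config E) : R :=
  p ^+ #|A| * (1 - p) ^+ (#|E| - #|A|) * q ^+ #|components A|.

Definition rc_measure (R : realType) (V : finType) (E : {set {set V}}) (p q : R)
    (A : config E) : R :=
  rc_weight p q A / \sum_(B : config E) rc_weight p q B.

Definition edges_within (V : finType) (E : {set {set V}}) (W : {set V}) :
    config E :=
  [set e : edge E | val e \subset W]%SET.

(* S is the set of activated components, and D the set of edges which are
   added in the last step. *)
Definition cm_kernel (R : realType) (V : finType) (E : {set {set V}}) (p q : R)
    (A B : config E) : R :=
  \sum_(S : {set {set V}} | S \subset components A)
    (q^-1) ^+ #|S| * (1 - q^-1) ^+ (#|components A| - #|S|) *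
    (let F := edges_within E (finset.cover S) in
     \sum_(D : config E | D \subset F)
       p ^+ #|D| * (1 - p) ^+ (#|F| - #|D|) *
       (B == (A :\: F) :|: D)%:R).

Definition glauber_kernel (R : realType) (V : finType) (E : {set {set V}})
    (p q : R) (A B : config E) : R :=
  \sum_(e : edge E) #|edge E|%:R^-1 *
    (let up := e |: A in let down := A :\ e in
     let r := rc_measure p q up / (rc_measure p q up + rc_measure p q down) in
     r * (B == up)%:R + (1 - r) * (B == down)%:R).

Definition complete_edges (n : nat) : {set {set 'I_n}} :=
  [set e : {set 'I_n} | #|e| == 2%N]%SET.

Definition tau_GD (R : realType) (n : nat) (p q : R) : \bar R :=
  mixing_time (@glauber_kernel R 'I_n (complete_edges n) p q)
              (@rc_measure R 'I_n (complete_edges n) p q).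

Definition tau_CM (R : realType) (n : nat) (p q : R) : \bar R :=
  mixing_time (@cm_kernel R 'I_n (complete_edges n) p q)
              (@rc_measure R 'I_n (complete_edges n) p q).

(* Main.v *)
Require Import Defs.
From mathcomp Require Import all_boot all_order all_algebra.
From mathcomp Require Import boolp reals ring lra.
Set Implicit Arguments.
Unset Strict Implicit.
Unset Printing Implicit Defensive.
Import Order.TTheory GRing.Theory Num.Theory.
Local Open Scope ring_scope.

(** A chain that mixes in T steps satisfies a Poincare inequality with constant
    O(T).  One Chayes-Machta step resamples independently all the edges inside
    the active region; given that region the single-edge resamplings are
    commuting orthogonal projections, so the Dirichlet form of the CM dynamics
    is at most the sum over edges of the single-edge ones, hence at most |E|
    times that of the Glauber dynamics.  The Poincare constant of the Glauber
    dynamics is therefore O(n^2 T).  Once every edge has been updated, the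
    density of its law with respect to the stationary measure is exp(O(n)), and
    O(n^3 T) further steps suffice to mix.  The burn-in takes O(n^3) steps. *)

(** Relaxation alone is not enough: [zeta] may be arbitrarily small, so the least stationary
    probability has no lower bound in terms of [n], and the density of a point mass is unbounded.
    Burn-in cures this because an update inserts an edge with probability at most [p]: a fully
    refreshed configuration [A] has probability at most [p ^+ #|A|], which is comparable with its
    stationary weight up to [q ^+ n / (1 - p) ^+ m], however small [p] is. The comparison of
    energies rests on expanding [q ^+ c(A)] into the sum of [(q - 1) ^+ #|I|] over sets [I] of
    components of [A], read as the inactive ones. For fixed [I] what remains is Bernoulli
    percolation restricted to configurations with the blocks of [I] as components, and the edges
    avoiding these blocks are free and independent. Norms of iterates replace spectral
    decompositions: the Poincare inequality comes from log-convexity of these norms. The final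
    distance is treated by duality, so the relaxation steps, last in time, act first on the test
    function; the burn-in estimate then only sees a function that is already small in mean. *)

(** * Weighted inner products and kernels as operators *)

Section InnerProduct.
Variables (R : realType) (T : finType).
Implicit Types (w f g h : T -> R) (P : T -> T -> R).

Definition ip w f g : R := \sum_x w x * f x * g x.

Definition op P f : T -> R := fun x => \sum_y P x y * f y.

Lemma opE P f x : op P f x = \sum_y P x y * f y. Proof. by []. Qed.

Lemma ipC w f g : ip w f g = ip w g f.
Proof. by apply: eq_bigr => x _; ring. Qed.

Lemma ipBr w f g h : ip w f (g \- h) = ip w f g - ip w f h.
Proof. by rewrite /ip -sumrB; apply: eq_bigr => x _ /=; ring. Qed.

Lemma ipBl w f g h : ip w (f \- g) h = ip w f h - ip w g h.
Proof. by rewrite ipC ipBr !(ipC _ h). Qed.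

Lemma ip_sumr (I : finType) w f (F : I -> T -> R) :
  ip w f (fun x => \sum_i F i x) = \sum_i ip w f (F i).
Proof.
rewrite /ip exchange_big; apply: eq_bigr => x _; exact: mulr_sumr.
Qed.

Lemma ipZr w f c g : ip w f (fun x => c * g x) = c * ip w f g.
Proof. by rewrite /ip mulr_sumr; apply: eq_bigr => x _; ring. Qed.

Lemma ip_ge0 w f : (forall x, 0 <= w x) -> 0 <= ip w f f.
Proof.
by move=> w0; apply: sumr_ge0 => x _; rewrite -mulrA mulr_ge0 // -expr2 sqr_ge0.
Qed.

(** Lagrange's identity: twice the difference of the two sides is a sum of squares with weights
    [w x * w y]. *)
Lemma ip_cauchy_schwarz w f g : (forall x, 0 <= w x) ->
  ip w f g ^+ 2 <= ip w f f * ip w g g.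
Proof.
move=> w0.
have : 0 <= \sum_x \sum_y w x * w y * (f x * g y - f y * g x) ^+ 2.
  apply: sumr_ge0 => x _; apply: sumr_ge0 => y _.
  by rewrite mulr_ge0 ?sqr_ge0 ?mulr_ge0.
have -> : \sum_x \sum_y w x * w y * (f x * g y - f y * g x) ^+ 2
    = ip w f f * ip w g g *+ 2 - ip w f g ^+ 2 *+ 2.
  have AE : ip w f f * ip w g g
    = \sum_x \sum_y w x * f x * f x * (w y * g y * g y) by exact: big_distrlr.
  have AE' : ip w f f * ip w g g
    = \sum_x \sum_y w y * f y * f y * (w x * g x * g x).
    by rewrite AE; exact: exchange_big.
  rewrite mulr2n {1}AE AE' expr2 /ip big_distrlr /=.
  rewrite -big_split -sumrMnl -sumrB /=.
  apply: eq_bigr => x _; rewrite -big_split -sumrMnl -sumrB /=.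
  by apply: eq_bigr => y _; ring.
by rewrite -mulrnBl pmulrn_lge0 // subr_ge0.
Qed.

Lemma opB P f g : op P (f \- g) = op P f \- op P g.
Proof. by apply: funext => x; rewrite /op /= -sumrB; apply: eq_bigr => y _; ring. Qed.

Lemma iter_opB P f g t : iter t (op P) (f \- g) = iter t (op P) f \- iter t (op P) g.
Proof. by elim: t => // t IH; rewrite !iterS IH opB. Qed.

Definition stochastic P := (forall x y, 0 <= P x y) /\ forall x, \sum_y P x y = 1.

Definition reversible w P := forall f g, ip w f (op P g) = ip w (op P f) g.

Lemma op_cst P (c : R) : stochastic P -> op P (fun=> c) = fun=> c.
Proof. by case=> _ P1; apply: funext => x; rewrite /op -mulr_suml P1 mul1r. Qed.

Lemma iter_op_cst P (c : R) t : stochastic P -> iter t (op P) (fun=> c) = fun=> c.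
Proof. by move=> sP; elim: t => // t IH; rewrite iterS IH op_cst. Qed.

Lemma le_op P f g x : stochastic P -> (forall y, f y <= g y) -> op P f x <= op P g x.
Proof. by case=> P0 _ le_fg; apply: ler_sum => y _; rewrite ler_wpM2l. Qed.

Lemma le_iter_op P f g t x : stochastic P -> (forall y, f y <= g y) ->
  iter t (op P) f x <= iter t (op P) g x.
Proof.
move=> sP; elim: t x => [|t IH] x le_fg //=.
by apply: le_op => // y; apply: IH.
Qed.

Lemma norm_iter_op P f t x : stochastic P ->
  `|iter t (op P) f x| <= iter t (op P) (fun y => `|f y|) x.
Proof.
move=> sP; elim: t x => [|t IH] x //=.
apply: (le_trans (ler_norm_sum _ _ _)); apply: ler_sum => y _.
by case: (sP) => P0 _; rewrite normrM ger0_norm // ler_wpM2l.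
Qed.

Lemma iter_op_sum (I : finType) P (c : I -> R) (F : I -> T -> R) t x :
  iter t (op P) (fun y => \sum_i c i * F i y) x
  = \sum_i c i * iter t (op P) (F i) x.
Proof.
elim: t x => [|t IH] x //=.
rewrite opE; under [LHS]eq_bigr do rewrite IH mulr_sumr.
rewrite exchange_big; apply: eq_bigr => i _; rewrite opE mulr_sumr.
by apply: eq_bigr => y _; ring.
Qed.

(** Bridge from matrix powers, in which mixing is stated, to iterates of an operator, in which the
    estimates are made. *)
Lemma op_law_at P t f x : \sum_y law_at P t x y * f y = iter t (op P) f x.
Proof.
elim: t x => [|t IH] x /=.
  rewrite (bigD1 x) //= big1 => [|y yx]; rewrite /law_at expr0 mxE.
    by rewrite eqxx mul1r addr0.
  by rewrite (inj_eq enum_rank_inj) eq_sym (negbTE yx) mul0r.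
rewrite opE; under [RHS]eq_bigr do rewrite -IH mulr_sumr.
rewrite exchange_big; apply: eq_bigr => y _.
rewrite /law_at exprS mxE (reindex enum_rank) /=; last first.
  by apply: onW_bij; apply: enum_rank_bij.
by rewrite mulr_suml; apply: eq_bigr => z _; rewrite mxE !enum_rankK mulrA.
Qed.

End InnerProduct.

(** * Bernoulli's inequality and log-convex sequences *)

Lemma bernoulli (R : realType) (x : R) n : 0 <= x -> 1 + n%:R * (x - 1) <= x ^+ n.
Proof.
move=> x0; elim: n => [|n IH]; first by rewrite expr0 mul0r addr0.
rewrite exprSr (le_trans _ (ler_wpM2r x0 IH)) // -subr_ge0.
rewrite (_ : _ - _ = n%:R * (x - 1) ^+ 2); first by rewrite mulr_ge0 ?sqr_ge0.
by rewrite -[n.+1]addn1 natrD; ring.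
Qed.

Lemma expr_bounded (R : realType) (x C : R) :
  0 <= x -> (forall k, x ^+ k <= C) -> x <= 1.
Proof.
move=> x0 xC; rewrite leNgt; apply/negP => x1.
have C0 : 0 <= C by apply: le_trans (xC 0%N); rewrite expr0.
have d0 : 0 < x - 1 by rewrite subr_gt0.
have := le_trans (bernoulli (Num.bound (C / (x - 1))) x0) (xC _).
apply/negP; rewrite -ltNge.
have := archi_boundP (divr_ge0 C0 (ltW d0)); rewrite ltr_pdivrMr // => h.
by rewrite (lt_trans h) // ltrDr.
Qed.

(** Log-convexity makes the successive ratios nondecreasing, so each is at least the first one. *)
Lemma log_convex_ge (R : realType) (a : nat -> R) :
  (forall t, 0 <= a t) -> (forall t, a t.+1 ^+ 2 <= a t * a t.+2) ->
  0 < a 0%N -> forall t, (a 1%N / a 0%N) ^+ t * a 0%N <= a t.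
Proof.
move=> a0 aC a00; have := a0 1%N; rewrite le_eqVlt => /predU1P[<-|a10] t.
  by case: t => [|t]; rewrite mul0r ?expr0 ?mul1r // expr0n mul0r a0.
set r := a 1%N / a 0%N; have r0 : 0 < r by rewrite divr_gt0.
have rat s : 0 < a s /\ r * a s <= a s.+1.
  elim: s => [|s [as0 IH]]; first by rewrite /r divfK ?gt_eqF.
  have as1 : 0 < a s.+1 by apply: lt_le_trans IH; rewrite mulr_gt0.
  split=> //; rewrite -(ler_pM2l as0) mulrA (le_trans _ (aC s)) //.
  by rewrite (mulrC (a s)) expr2 ler_pM2r.
elim: t => [|t IH]; first by rewrite expr0 mul1r.
by rewrite exprS -mulrA (le_trans (ler_wpM2l (ltW r0) IH)) //; case: (rat t).
Qed.

(** * From mixing to a Poincare inequality, and from there to decay in mean square *)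

Section Mixing.
Variables (R : realType) (T : finType) (w : T -> R) (P : T -> T -> R).
Hypotheses (w0 : forall x, 0 <= w x) (w1 : \sum_x w x = 1).
Hypotheses (sP : stochastic P) (rP : reversible w P).

Lemma ip_iter_op f t :
  ip w (fun=> 1) (iter t (op P) f) = ip w (fun=> 1) f.
Proof. by elim: t => // t IH; rewrite iterS rP op_cst. Qed.

Lemma stationary y : \sum_x w x * P x y = w y.
Proof.
have := rP (fun=> 1) (fun z => (z == y)%:R).
rewrite op_cst // /ip [RHS](bigD1 y) //= eqxx !mulr1.
rewrite [X in _ = _ + X]big1 ?addr0 => [<-|z /negbTE ->]; last by rewrite mulr0.
apply: eq_bigr => x _; rewrite mulr1 /op (bigD1 y) //= eqxx mulr1 big1 ?addr0 //.
by move=> z /negbTE ->; rewrite mulr0.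
Qed.

(** A stochastic kernel contracts the [l1] norm and fixes [w]. This lets all starting points be
    compared at a common time. *)
Lemma tv_dist_anti x s t : (s <= t)%N ->
  tv_dist (law_at P t x) w <= tv_dist (law_at P s x) w.
Proof.
elim: t => [|t IH]; first by rewrite leqn0 => /eqP ->.
rewrite leq_eqVlt => /predU1P[->//|/IH]; apply: le_trans.
rewrite ler_wpM2l ?invr_ge0 //.
have lawS y : law_at P t.+1 x y = \sum_z law_at P t x z * P z y.
  rewrite /law_at exprSr mxE (reindex enum_rank) /=; last first.
    by apply: onW_bij; apply: enum_rank_bij.
  by apply: eq_bigr => z _; rewrite !mxE !enum_rankK.
apply: (@le_trans _ _ (\sum_y \sum_z `|law_at P t x z - w z| * P z y)).
  apply: ler_sum => y _; rewrite lawS -stationary -sumrB.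
  apply: le_trans (ler_norm_sum _ _ _) _; apply: ler_sum => z _.
  by case: (sP) => P0 _; rewrite -mulrBl normrM (ger0_norm (P0 _ _)).
rewrite exchange_big; apply: ler_sum => z _ /=.
by rewrite -mulr_sumr; case: sP => _ ->; rewrite mulr1.
Qed.

Lemma norm_iter_op_mixed f t (B : R) : (forall x, tv_dist (law_at P t x) w <= 4^-1) ->
  ip w (fun=> 1) f = 0 -> (forall x, `|f x| <= B) ->
  forall x, `|iter t (op P) f x| <= 2^-1 * B.
Proof.
move=> mix f0 fB x; rewrite -op_law_at.
have -> : \sum_y law_at P t x y * f y = \sum_y (law_at P t x y - w y) * f y.
  have <- : \sum_y (law_at P t x y * f y - w y * f y)
      = \sum_y (law_at P t x y - w y) * f y.
    by apply: eq_bigr => y _; rewrite mulrBl.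
  rewrite sumrB (_ : \sum_y w y * f y = 0) ?subr0 // -[RHS]f0.
  by rewrite /ip; apply: eq_bigr => y _; rewrite mulr1.
apply: le_trans (ler_norm_sum _ _ _) _.
have B0 : 0 <= B by apply: le_trans (fB x).
apply: (@le_trans _ _ (\sum_y `|law_at P t x y - w y| * B)).
  by apply: ler_sum => y _; rewrite normrM ler_wpM2l.
rewrite -mulr_suml ler_wpM2r //; have := mix x; rewrite /tv_dist.
by set S := \sum_y _; lra.
Qed.

(** Mixing pushes [a (k * t)] below a constant times [4^-k], while log-convexity keeps it above
    [r ^+ (k * t) * a 0]. Hence [r ^+ t <= 1/4], and Bernoulli's inequality turns this into a lower
    bound on [1 - r]. *)
Lemma poincare_of_mixing f t : (forall x, tv_dist (law_at P t x) w <= 4^-1) ->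
  ip w (fun=> 1) f = 0 -> 3 * ip w f f <= 8 * t%:R * ip w f (f \- op P f).
Proof.
move=> mix f0; pose a s := ip w (iter s (op P) f) (iter s (op P) f).
have a_ge0 s : 0 <= a s by apply: ip_ge0.
have aC s : a s.+1 ^+ 2 <= a s * a s.+2.
  rewrite /a {1}iterS -rP -iterS; exact: ip_cauchy_schwarz.
(* This is the nonnegativity of the squared norm of [f - P f]. *)
have E2 : a 0%N - a 1%N <= 2 * ip w f (f \- op P f).
  have := ip_ge0 (f \- op P f) w0; rewrite !ipBr !ipBl /a /= (ipC _ (op P f) f).
  by lra.
rewrite -[ip w f f]/(a 0%N).
have [a00|a0N] := ltrP 0 (a 0%N); last first.
  have a00 : a 0%N = 0 by apply: le_anti; rewrite a0N a_ge0.
  have a10 : a 1%N = 0.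
    apply/eqP; rewrite -sqrf_eq0 eq_le sqr_ge0 andbT.
    by apply: le_trans (aC 0%N) _; rewrite a00 mul0r.
  by rewrite a00 mulr0 !mulr_ge0 // -(pmulr_rge0 _ (ltr0Sn R 1)); lra.
pose r := a 1%N / a 0%N; have r0 : 0 <= r by rewrite divr_ge0.
(* The contraction is in sup norm but [a] is a mean square. The constant lost in passing between
   them disappears since the bound holds for every [k]. *)
have rt : 4 * r ^+ t <= 1.
  pose B := \sum_x `|f x|.
  have fB x : `|f x| <= B by rewrite /B (bigD1 x) //= lerDl sumr_ge0.
  have itB k x : `|iter (k * t) (op P) f x| <= 2^-1 ^+ k * B.
    elim: k x => [|k IH] x; first by rewrite mul0n expr0 mul1r /=.
    rewrite mulSn iterD exprS -mulrA; apply: norm_iter_op_mixed => //.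
    by rewrite ip_iter_op.
  apply: (@expr_bounded _ _ (B ^+ 2 / a 0%N)) => [|k].
    by rewrite mulr_ge0 ?exprn_ge0.
  rewrite ler_pdivlMr // exprMn -exprM mulnC.
  apply: (@le_trans _ _ (4 ^+ k * a (k * t)%N)).
    by rewrite -mulrA ler_wpM2l ?exprn_ge0 // log_convex_ge.
  have -> : B ^+ 2 = 4 ^+ k * (2^-1 ^+ k * B) ^+ 2.
    rewrite exprMn mulrA -exprM mulnC exprM -exprMn.
    by rewrite (_ : 4 * 2^-1 ^+ 2 = 1) ?expr1n ?mul1r //; field.
  rewrite ler_wpM2l ?exprn_ge0 //.
  rewrite [leRHS](_ : _ = (\sum_x w x) * (2^-1 ^+ k * B) ^+ 2); last first.
    by rewrite w1 mul1r.
  rewrite mulr_suml.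
  apply: ler_sum => x _; rewrite -mulrA ler_wpM2l // -expr2.
  rewrite -(real_normK (num_real _)) lerXn2r ?itB ?nnegrE //.
  by rewrite mulr_ge0 ?exprn_ge0 ?invr_ge0 ?sumr_ge0.
have := bernoulli t r0.
have E1 : a 0%N - a 1%N = a 0%N * (1 - r).
  by rewrite mulrBr mulr1 /r mulrCA divff ?gt_eqF // mulr1.
rewrite E1 in E2; move=> br; have trr : 3 <= 4 * t%:R * (1 - r) by lra.
have := ler_wpM2l (ler0n R t) E2; have := ler_wpM2l (ltW a00) trr; lra.
Qed.

(** The first inequality assumed on [P] says [P^2 <= P] as quadratic forms. It rules out eigenvalues
    near -1, which a Poincare inequality does not control. *)
Lemma ip_iter_op_decay f k t : 1 <= k ->
  (forall g, ip w (op P g) (op P g) <= ip w g (op P g)) ->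
  (forall g, ip w (fun=> 1) g = 0 -> ip w g g <= k * ip w g (g \- op P g)) ->
  ip w (fun=> 1) f = 0 ->
  ip w (iter t (op P) f) (iter t (op P) f) <= (1 - k^-1) ^+ t * ip w f f.
Proof.
move=> k1 contr gap f0; elim: t => [|t IH] /=; first by rewrite mul1r.
have k0 : 0 < k by apply: lt_le_trans k1.
rewrite exprS -mulrA; apply: le_trans (ler_wpM2l _ IH); last first.
  by rewrite subr_ge0 invf_le1.
set g := iter t _ f; apply: (le_trans (contr g)).
have := gap g; rewrite ip_iter_op => /(_ f0); rewrite -ler_pdivrMl // ipBr.
by lra.
Qed.

End Mixing.

(** * Sums over subsets *)

Section SubsetSums.
Variables (R : realType) (X : finType).
Implicit Types (A D F : {set X}) (e : X).

Lemma sum_setU1 e (G : {set X} -> R) :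
  \sum_(A : {set X}) G A = \sum_(A : {set X} | e \notin A) (G (e |: A) + G A).
Proof.
rewrite (bigID (fun A : {set X} => e \in A)) /= big_split /=; congr (_ + _).
rewrite (reindex_onto (fun A => e |: A) (fun A => A :\ e)) /=; last first.
  by move=> A eA; rewrite setD1K.
apply: eq_bigl => A; rewrite setU11 /=; apply/eqP/idP => [<-|/setU1K //].
by rewrite setD11.
Qed.

Lemma sum_subset_setU1 e F (G : {set X} -> R) : e \notin F ->
  \sum_(D : {set X} | D \subset e |: F) G D = \sum_(D : {set X} | D \subset F) (G (e |: D) + G D).
Proof.
move=> eF; rewrite big_mkcond (sum_setU1 e) [RHS]big_mkcond [LHS]big_mkcond /=.
apply: eq_bigr => D _.
have [eD|eD] /= := boolP (e \in D).
  by case: ifP => // /subsetP/(_ _ eD); rewrite (negbTE eF).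
have -> : (D \subset e |: F) = (D \subset F).
  apply/idP/idP => [|/subset_trans]; last by apply; exact: subsetUr.
  by rewrite -subDset (setDidPl _) // disjoint_sym disjoints1.
have -> : (e |: D \subset e |: F) = (D \subset F).
  apply/idP/idP => [|DF]; last exact: setUS.
  by move=> /(setSD [set e]); rewrite !setU1K.
by case: ifP => //; rewrite addr0.
Qed.

Lemma sum_subset_binomial (a b : R) F :
  \sum_(D : {set X} | D \subset F) a ^+ #|D| * b ^+ (#|F| - #|D|) = (a + b) ^+ #|F|.
Proof.
have [k] := ubnP #|F|; elim: k F => // k IH F.
have [->|[e eF]] := set_0Vmem F.
  rewrite (eq_bigl (pred1 set0)) ?big_pred1_eq ?cards0 ?mul1r // => D.
  by rewrite subset0.
rewrite -(setD1K eF); set F' := F :\ e => kF.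
have eF' : e \notin F' by rewrite setD11.
rewrite sum_subset_setU1 // big_split /=.
rewrite cardsU1 eF' add1n ltnS in kF *; rewrite exprS -IH // mulrDl !mulr_sumr.
congr (_ + _); apply: eq_bigr => D DF; have le_DF := subset_leq_card DF.
  rewrite cardsU1 (contra (subsetP DF e)) // add1n subSS exprS mulrA //.
by rewrite subSn // exprS mulrCA.
Qed.

End SubsetSums.

(** * Single-edge heat-bath updates as projections *)

Section HeatBath.
Variables (R : realType) (X : finType).
Implicit Types (A B D F : {set X}) (e : X) (w r f g h : {set X} -> R) (s : seq X).

Definition hb e r f : {set X} -> R :=
  fun A => r A * f (e |: A) + (1 - r A) * f (A :\ e).

(** An update whose rate ignores the current state of [e] is idempotent; detailed balance,
    [balanced] below, makes it self-adjoint for [w]. Together they give an orthogonal projection. *)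
Definition blind e r := forall A, r (e |: A) = r A /\ r (A :\ e) = r A.

Definition balanced w e r :=
  forall A, e \notin A -> w (e |: A) * (1 - r A) = w A * r A.

Lemma setU1D1 e A : e |: (A :\ e) = e |: A.
Proof. by apply/setP => x; rewrite !inE; case: eqP. Qed.

Lemma setU1U1 e A : e |: (e |: A) = e |: A.
Proof. by rewrite setUA setUid. Qed.

Lemma setD1U1 e A : (e |: A) :\ e = A :\ e.
Proof. by apply/setP => x; rewrite !inE; case: eqP. Qed.

Lemma setD1D1 e A : (A :\ e) :\ e = A :\ e.
Proof. by apply/setP => x; rewrite !inE; case: eqP. Qed.

Definition setE1 := (setU1D1, setU1U1, setD1U1, setD1D1).

Lemma setD1_id e A : e \notin A -> A :\ e = A.
Proof. by move=> eA; apply/setDidPl; rewrite disjoint_sym disjoints1. Qed.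

Lemma hb_idem e r f : blind e r -> hb e r (hb e r f) = hb e r f.
Proof.
move=> br; apply: funext => A; rewrite /hb !setE1 !(proj1 (br _)) !(proj2 (br _)).
by ring.
Qed.

Lemma hb_sym w e r f g : blind e r -> balanced w e r ->
  ip w f (hb e r g) = ip w (hb e r f) g.
Proof.
move=> br bw; rewrite /ip !(sum_setU1 e); apply: eq_bigr => A eA.
rewrite /hb !setE1 (proj1 (br _)) setD1_id //.
have := bw _ eA; set a := w _; set b := w A => bw'.
apply/eqP; rewrite -subr_eq0; apply/eqP.
transitivity ((a * (1 - r A) - b * r A) * (f (e |: A) * g A - f A * g (e |: A))).
  by ring.
by rewrite bw' subrr mul0r.
Qed.

Lemma hb_energy w e r f : blind e r -> balanced w e r ->
  ip w f (f \- hb e r f)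
  = \sum_(A : {set X} | e \notin A) w A * r A * (f (e |: A) - f A) ^+ 2.
Proof.
move=> br bw; rewrite /ip !(sum_setU1 e); apply: eq_bigr => A eA.
rewrite /hb /= !setE1 (proj1 (br _)) setD1_id //.
have := bw _ eA; set a := w _; set b := w A => bw'.
transitivity (a * (1 - r A) * f (e |: A) * (f (e |: A) - f A)
  + b * r A * f A * (f A - f (e |: A))); first by ring.
by rewrite bw'; ring.
Qed.

Lemma hbB e r f g : hb e r (f \- g) = hb e r f \- hb e r g.
Proof. by apply: funext => A; rewrite /hb /=; ring. Qed.

End HeatBath.

(** * Resampling a block of edges at constant rate *)

Section BlockResampling.
Variables (R : realType) (X : finType) (p : R).
Implicit Types (A B D F : {set X}) (e : X) (w f g h : {set X} -> R) (s : seq X).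

Definition hbs s f := foldr (fun e => hb e (fun=> p)) f s.

Lemma hbC e e' f : hb e (fun=> p) (hb e' (fun=> p) f)
  = hb e' (fun=> p) (hb e (fun=> p) f).
Proof.
have [->//|ne] := eqVneq e e'; apply: funext => A; rewrite /hb.
have -> : e |: (e' |: A) = e' |: (e |: A) by rewrite setUCA.
have -> : (A :\ e) :\ e' = (A :\ e') :\ e by rewrite !setDDl setUC.
have -> : e |: A :\ e' = (e |: A) :\ e'.
  by apply/setP => x; rewrite !inE; case: (eqVneq x e') => // ->; rewrite eq_sym (negbTE ne).
have -> : (e' |: A) :\ e = e' |: A :\ e.
  by apply/setP => x; rewrite !inE; case: (eqVneq x e) => // ->; rewrite (negbTE ne).
ring.
Qed.

Lemma hbs_hbC s e f : hbs s (hb e (fun=> p) f) = hb e (fun=> p) (hbs s f).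
Proof. by elim: s => //= e' s ->; rewrite hbC. Qed.

Lemma blind_cst e : blind e (fun=> p). Proof. by []. Qed.

Lemma hbsB s f g : hbs s (f \- g) = hbs s f \- hbs s g.
Proof. by elim: s => //= e s ->; rewrite hbB. Qed.

Lemma hbs_idem s f : hbs s (hbs s f) = hbs s f.
Proof.
by elim: s f => //= e s IH f; rewrite hbs_hbC hb_idem ?IH //; exact: blind_cst.
Qed.

Lemma hbs_sym w s f g : {in s, forall e, balanced w e (fun=> p)} ->
  ip w f (hbs s g) = ip w (hbs s f) g.
Proof.
elim: s g f => //= e s IH g f bw; have be := bw e (mem_head _ _).
rewrite hb_sym // IH ?hbs_hbC // => e' e's.
by apply: bw; rewrite inE e's orbT.
Qed.

(** For an orthogonal projection [Q], the form [<f, (1 - Q) f>] is the squared norm of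
    [(1 - Q) f]. *)
Lemma hbs_energy_ge0 w s f : (forall A, 0 <= w A) ->
  {in s, forall e, balanced w e (fun=> p)} -> 0 <= ip w f (f \- hbs s f).
Proof.
move=> w0 bw; have := ip_ge0 (f \- hbs s f) w0; rewrite ipBl.
by rewrite -(hbs_sym f (f \- hbs s f) bw) hbsB hbs_idem (ipBr _ _ (hbs s f)) subrr subr0.
Qed.

(* Commuting orthogonal projections: (1 - Q)(1 - Q') is again a projection, so
   1 - Q Q' <= (1 - Q) + (1 - Q'). *)
Lemma efron_stein w s f : (forall A, 0 <= w A) ->
  {in s, forall e, balanced w e (fun=> p)} ->
  ip w f (f \- hbs s f) <= \sum_(e <- s) ip w f (f \- hb e (fun=> p) f).
Proof.
move=> w0; elim: s => [|e s IH] bw.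
  by rewrite big_nil ipBr subrr.
have be := bw e (mem_head _ _).
have {}bw : {in s, forall e, balanced w e (fun=> p)}.
  by move=> e' e's; apply: bw; rewrite inE e's orbT.
rewrite big_cons (le_trans _ (lerD (lexx _) (IH bw))) // -subr_ge0 /=.
have := hbs_energy_ge0 (f \- hb e (fun=> p) f) w0 bw.
have bE := @blind_cst e.
have -> : ip w (f \- hb e (fun=> p) f)
    ((f \- hb e (fun=> p) f) \- hbs s (f \- hb e (fun=> p) f))
  = ip w f ((f \- hb e (fun=> p) f) \- hbs s (f \- hb e (fun=> p) f)).
  set g := f \- _; rewrite /g ipBl -/g -hb_sym // [hb e _ (g \- _)]hbB -hbs_hbC.
  have -> : hb e (fun=> p) g = hb e (fun=> p) f \- hb e (fun=> p) f.
    by rewrite hbB hb_idem.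
  by rewrite hbsB !ipBr !subrr !subr0.
by rewrite hbsB hbs_hbC !ipBr; lra.
Qed.

(** Updating edges one after another amounts to drawing them all at once; so the inner sum of
    [cm_kernel] becomes a product of commuting projections. *)
Lemma hbsE s f A : uniq s -> let F := [set e in s] in
  hbs s f A
  = \sum_(D : {set X} | D \subset F) p ^+ #|D| * (1 - p) ^+ (#|F| - #|D|) * f ((A :\: F) :|: D).
Proof.
elim: s f A => [|e s IH] f A /=.
  have -> : [set e in [::]] = set0 :> {set X} by apply/setP => x; rewrite !inE.
  rewrite (eq_bigl (pred1 set0)) => [|D]; last by rewrite subset0.
  by rewrite big_pred1_eq cards0 !mul1r setD0 setU0.
move=> /andP[es us]; set F := [set e in s].
have eF : e \notin F by rewrite inE.
have -> : [set x in e :: s] = e |: F by apply/setP => x; rewrite !inE.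
rewrite sum_subset_setU1 // -hbs_hbC IH //.
apply: eq_bigr => D DF; rewrite -/F.
have eD : e \notin D by apply: contra eF; exact: (subsetP DF).
rewrite !cardsU1 eF eD !add1n subSS subSn ?subset_leq_card // !exprS /hb.
have -> : e |: (A :\: F :|: D) = A :\: (e |: F) :|: (e |: D).
  by apply/setP => x; rewrite !inE; case: (eqVneq x e) => //= ->; rewrite orbT.
have -> : (A :\: F :|: D) :\ e = A :\: (e |: F) :|: D.
  by apply/setP => x; rewrite !inE; case: (eqVneq x e) => [->|] //=; rewrite (negbTE eD).
by ring.
Qed.

End BlockResampling.

(** * Connected components under changes of edges *)

Section Components.
Variables (V : finType) (E : {set {set V}}).
Implicit Types (A B : {set edge E}) (I S : {set {set V}}) (X : {set V}).

Lemma adjacent_sym A : symmetric (@adjacent V E A).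
Proof.
by move=> u v; apply/exists_inP/exists_inP => -[e eA /eqP ve]; exists e; rewrite // ve setUC.
Qed.

Lemma connect_equiv A : {in [set: V] & &, equivalence_rel (connect (@adjacent V E A))}.
Proof.
move=> x y z _ _ _; split=> [|xy]; first exact: connect0.
apply/idP/idP; apply: connect_trans => //.
by rewrite (sym_connect_sym (@adjacent_sym A)).
Qed.

Lemma componentsP A X :
  reflect (exists x, X = [set y | connect (@adjacent V E A) x y])
    (X \in @components V E A).
Proof.
apply: (iffP imsetP) => [[x _ ->]|[x ->]]; exists x => //.
  by apply/setP => y; rewrite !inE.
by apply/setP => y; rewrite !inE.
Qed.

Lemma components_partition A : partition (@components V E A) [set: V].
Proof. exact: equivalence_partitionP (@connect_equiv A). Qed.

Lemma card_components_le A : (#|@components V E A| <= #|V|)%N.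
Proof. by rewrite -cardsT; apply: leq_imset_card. Qed.

(** Sending a component of [A] to the union of the [B]-components meeting it reaches every component
    of [B]. *)
Lemma card_components_anti A B : A \subset B ->
  (#|@components V E B| <= #|@components V E A|)%N.
Proof.
move=> AB; pose cl x := [set y | connect (@adjacent V E B) x y].
apply: leq_trans (leq_imset_card (fun X : {set V} => \bigcup_(x in X) cl x) _).
apply/subset_leq_card/subsetP => _ /componentsP[x ->].
have sub : subrel (connect (@adjacent V E A)) (connect (@adjacent V E B)).
  apply: connect_sub => u v /exists_inP[e eA ve]; apply/connect1/exists_inP.
  by exists e; rewrite ?(subsetP AB).
apply/imsetP; exists [set y | connect (@adjacent V E A) x y].
  by apply/componentsP; exists x.
apply/setP => z; apply/idP/bigcupP => [xz|[y]].
  by exists x; rewrite // inE connect0.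
by rewrite !inE => /sub; apply: connect_trans.
Qed.

(** A walk from inside [X] can leave [X] only along an edge meeting [X], and on those edges [A] and
    [B] agree. *)
Lemma components_local A B X :
  (forall e : edge E, ~~ [disjoint val e & X] -> (e \in A) = (e \in B)) ->
  X \in @components V E A -> X \in @components V E B.
Proof.
move=> agree /componentsP[x defX]; apply/componentsP; exists x.
have adjE u v : u \in X -> adjacent A u v = adjacent B u v.
  move=> uX; apply: eq_existsb => e.
  have [ve|] := eqVneq (val e) [set u; v]; last by rewrite !andbF.
  rewrite agree // ve; apply/pred0Pn; exists u.
  by rewrite /= uX !inE eqxx.
have XS u v : u \in X -> adjacent A u v -> v \in X.
  by rewrite defX !inE => xu uv; apply: connect_trans xu (connect1 uv).
have xX : x \in X by rewrite defX inE connect0.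
apply/setP => y; rewrite [RHS]inE; apply/idP/idP => [|/connectP[s]].
  rewrite defX inE => /connectP[s].
  elim: s {1 2 3 4}x xX => [|v s IH] u uX /= => [_ ->|]; first exact: connect0.
  case/andP=> uv vs ys; apply: connect_trans (IH v (XS _ _ uX uv) vs ys).
  by apply: connect1; rewrite -adjE.
elim: s {1 2 3}x xX => [|v s IH] u uX /= => [_ ->//|].
by case/andP; rewrite -adjE // => uv; apply: IH; apply: XS uv.
Qed.

Lemma sub_components_local A B I :
  (forall e, e \notin edges_within E (~: finset.cover I) -> (e \in A) = (e \in B)) ->
  I \subset @components V E A -> I \subset @components V E B.
Proof.
move=> agree IA; apply/subsetP => X XI.
apply: components_local (subsetP IA _ XI) => e /pred0Pn[u /andP[ue uX]].
apply: agree; rewrite inE; apply/negP => /subsetP/(_ _ ue).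
by rewrite inE => /negP; apply; apply/bigcupP; exists X.
Qed.

(** Inactive blocks survive any change of an edge that avoids them; this keeps free resampling of
    the active region reversible once [I] is fixed. *)
Lemma sub_components_setU1 A I e : e \in edges_within E (~: finset.cover I) ->
  (I \subset @components V E (e |: A)) = (I \subset @components V E A).
Proof.
move=> eF; apply/idP/idP; apply: sub_components_local => e' e'F; rewrite in_setU1;
  by case: eqVneq e'F => // ->; rewrite eF.
Qed.

(** Expresses the active vertices through the inactive blocks, so that the resampled region depends
    on those blocks only and not on [A]. *)
Lemma cover_componentsD A S : S \subset @components V E A ->
  finset.cover S = ~: finset.cover (@components V E A :\: S).
Proof.
move=> SC; have /and3P[/eqP cov triv _] := components_partition A.
apply/setP => v; rewrite in_setC; apply/bigcupP/negP.
  case=> X XS vX /bigcupP[Y]; rewrite inE => /andP[YS YC vY].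
  move: YS; rewrite -(def_pblock triv YC vY).
  by rewrite (def_pblock triv (subsetP SC _ XS) vX) XS.
move=> vC; have vcov : v \in finset.cover (@components V E A) by rewrite cov.
exists (pblock (@components V E A) v); last by rewrite mem_pblock.
apply: contraT => pS; case: vC; apply/bigcupP.
by exists (pblock (@components V E A) v); rewrite ?mem_pblock // inE pS pblock_mem.
Qed.

End Components.

(** * Random-cluster weights and the Chayes-Machta operator *)

Section Weights.
Variables (R : realType) (V : finType) (E : {set {set V}}) (p q : R).
Hypotheses (p0 : 0 < p) (p1 : p < 1) (q1 : 1 < q).
Implicit Types (A B D F : {set edge E}) (I S : {set {set V}}) (e : edge E).
Implicit Types (f g h : {set edge E} -> R).

Definition bern A : R := p ^+ #|A| * (1 - p) ^+ (#|E| - #|A|).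

Definition rcZ : R := \sum_(B : config E) rc_weight p q B.

Local Notation mu := (@rc_measure R V E p q).
Local Notation comp := (@components V E).

Lemma q_gt0 : 0 < q. Proof. exact: lt_trans q1. Qed.

Lemma rc_weightE A : rc_weight p q A = bern A * q ^+ #|comp A|.
Proof. by []. Qed.

Lemma bern_gt0 A : 0 < bern A.
Proof. by rewrite mulr_gt0 ?exprn_gt0 // subr_gt0. Qed.

Lemma rc_weight_gt0 A : 0 < rc_weight p q A.
Proof. by rewrite rc_weightE mulr_gt0 ?bern_gt0 ?exprn_gt0 ?q_gt0. Qed.

Lemma rcZ_gt0 : 0 < rcZ.
Proof.
rewrite /rcZ (bigD1 set0) //= ltr_wpDr ?rc_weight_gt0 //.
by apply: sumr_ge0 => A _; apply/ltW/rc_weight_gt0.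
Qed.

Lemma rc_measure_gt0 A : 0 < mu A.
Proof. by rewrite divr_gt0 ?rc_weight_gt0 ?rcZ_gt0. Qed.

Lemma rc_measure_sum1 : \sum_A mu A = 1.
Proof. by rewrite -mulr_suml divff // gt_eqF // rcZ_gt0. Qed.

Lemma card_edge : #|{: edge E}| = #|E|.
Proof. by rewrite card_sig. Qed.

Lemma bern_sum1 : \sum_(A : {set edge E}) bern A = 1.
Proof.
have := sum_subset_binomial p (1 - p) [set: edge E].
rewrite (_ : p + (1 - p) = 1); last by ring.
rewrite expr1n cardsT card_edge => <-.
by rewrite [RHS](eq_bigl predT) // => A; rewrite subsetT.
Qed.

Lemma rcZ_le : rcZ <= q ^+ #|V|.
Proof.
rewrite -[leRHS]mul1r -bern_sum1 mulr_suml; apply: ler_sum => A _.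
by rewrite rc_weightE ler_wpM2l ?(ltW (bern_gt0 A)) // ler_weXn2l ?(ltW q1) ?card_components_le.
Qed.

Lemma bern_setU1 A e : e \notin A -> bern (e |: A) * (1 - p) = bern A * p.
Proof.
move=> eA; rewrite /bern cardsU1 eA add1n.
have : A \proper [set: edge E].
  by apply/properP; split; [exact: subsetT | exists e; rewrite ?inE].
move=> /proper_card; rewrite cardsT card_edge.
move: #|A| #|E| => k m km; rewrite -[in RHS](subnSK km).
by rewrite !exprS; ring.
Qed.

Lemma op_cm f A : op (@cm_kernel R V E p q) f A
  = \sum_(S : {set {set V}} | S \subset comp A)
      q^-1 ^+ #|S| * (1 - q^-1) ^+ (#|comp A| - #|S|)
      * hbs p (enum (edges_within E (finset.cover S))) f A.
Proof.
rewrite /op /cm_kernel; under eq_bigr do rewrite mulr_suml.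
rewrite exchange_big /=; apply: eq_bigr => S _.
under [LHS]eq_bigr do rewrite -[_ * _ * _ * f _]mulrA.
rewrite -mulr_sumr; congr (_ * _).
rewrite hbsE ?enum_uniq // set_enum.
under eq_bigr do rewrite mulr_suml.
rewrite exchange_big /=; apply: eq_bigr => D _.
set F := edges_within _ _; rewrite (bigD1 (A :\: F :|: D)) //= eqxx mulr1 big1 ?addr0 //.
by move=> B /negbTE ->; rewrite mulr0 mul0r.
Qed.

(* In terms of the set I of inactive blocks, the factor q^c(A) is absorbed into
   (q - 1)^|I|, which is unchanged by resampling the active region. *)
Lemma op_cm_inactive f A : rc_weight p q A * op (@cm_kernel R V E p q) f A
  = \sum_(I : {set {set V}} | I \subset comp A)
      (q - 1) ^+ #|I| * bern A
      * hbs p (enum (edges_within E (~: finset.cover I))) f A.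
Proof.
rewrite op_cm mulr_sumr.
rewrite (reindex_onto (fun I => comp A :\: I) (fun S => comp A :\: S)) /=; last first.
  by move=> S SC; rewrite setDDr setDv set0U; apply/setIidPr.
have eqI I : (comp A :\: I \subset comp A) && (comp A :\: (comp A :\: I) == I)
    = (I \subset comp A).
  by rewrite subsetDl setDDr setDv set0U /=; apply/eqP/setIidPr.
rewrite (eq_bigl _ _ eqI); apply: eq_bigr => I IC.
rewrite (cover_componentsD (subsetDl _ _)) setDDr setDv set0U (setIidPr IC).
rewrite mulrA; congr (_ * _); rewrite rc_weightE cardsD (setIidPr IC).
move: (subset_leq_card IC) (bern A); move: #|I| #|comp A| => i c ic b.
have q_neq0 := lt0r_neq0 q_gt0.
rewrite subKn // exprVn -{1}(subnK ic) exprD.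
have -> : q - 1 = q * (1 - q^-1) by rewrite mulrBr mulr1 divff.
by rewrite exprMn; field; rewrite expf_neq0.
Qed.

End Weights.

(** * Comparison of the two Dirichlet forms *)

Lemma mean_sqr_le (R : realType) (T : finType) (a : T -> R) : (0 < #|T|)%N ->
  (#|T|%:R^-1 * \sum_x a x) ^+ 2 <= #|T|%:R^-1 * \sum_x a x ^+ 2.
Proof.
rewrite -(ltr0n R) => m0.
have := @ip_cauchy_schwarz R T (fun=> 1) (fun=> 1) a (fun=> ler01).
rewrite /ip !mulr1 sumr_const.
under eq_bigr do rewrite !mul1r.
under [X in _ * X]eq_bigr do rewrite mul1r -expr2.
move: m0; rewrite -[1 *+ _]/(_%:R) => m0 h.
rewrite exprMn expr2 -mulrA ler_pM2l ?invr_gt0 // ler_pdivrMl //.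
Qed.

Section Comparison.
Variables (R : realType) (V : finType) (E : {set {set V}}) (p q : R).
Hypotheses (p0 : 0 < p) (p1 : p < 1) (q1 : 1 < q) (E0 : (0 < #|{: edge E}|)%N).
Implicit Types (A B D F : {set edge E}) (I S : {set {set V}}) (e : edge E).
Implicit Types (f g h : {set edge E} -> R).

Local Notation mu := (@rc_measure R V E p q).
Local Notation comp := (@components V E).
Local Notation cm := (@cm_kernel R V E p q).
Local Notation gd := (@glauber_kernel R V E p q).
Local Notation Z := (@rcZ R V E p q).
Local Notation m := #|{: edge E}|.

Let mu_gt0 A : 0 < mu A := rc_measure_gt0 p0 p1 q1 A.
Let mu_ge0 A : 0 <= mu A := ltW (mu_gt0 A).
Let Z_gt0 : 0 < Z := rcZ_gt0 E p0 p1 q1.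
Let b_gt0 A : 0 < bern p A := bern_gt0 p0 p1 A.

(** Unnormalised percolation measure on the event that the blocks of [I] are components. Weighted by
    [(q - 1) ^+ #|I|] and summed over [I], these measures add up to [Z] times [mu]. *)
Definition inactive_weight I A : R := (I \subset comp A)%:R * bern p A.

Local Notation outside I := (edges_within E (~: finset.cover I)).

Lemma inactive_weight_ge0 I A : 0 <= inactive_weight I A.
Proof. by rewrite mulr_ge0 // ltW. Qed.

Lemma inactive_weight_balanced I :
  {in enum (outside I), forall e, balanced (inactive_weight I) e (fun=> p)}.
Proof.
move=> e; rewrite mem_enum => eF A eA; rewrite /inactive_weight.
by rewrite sub_components_setU1 // -[LHS]mulrA -[RHS]mulrA bern_setU1.
Qed.

Lemma sum_inactive A :
  \sum_(I : {set {set V}} | I \subset comp A) (q - 1) ^+ #|I| = q ^+ #|comp A|.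
Proof.
rewrite -[q in RHS](subrK 1) -sum_subset_binomial.
by apply: eq_bigr => I _; rewrite expr1n mulr1.
Qed.

Lemma ip_sum_inactive f (G : {set {set V}} -> {set edge E} -> R) :
  \sum_(A : {set edge E}) f A * (\sum_(I : {set {set V}} | I \subset comp A)
      (q - 1) ^+ #|I| * bern p A * G I A)
  = \sum_(I : {set {set V}}) (q - 1) ^+ #|I| * ip (inactive_weight I) f (G I).
Proof.
under eq_bigr do rewrite big_mkcond mulr_sumr.
rewrite exchange_big; apply: eq_bigr => I _; rewrite /ip mulr_sumr.
apply: eq_bigr => A _; rewrite /inactive_weight.
move: (_ ^+ #|I|) (bern p A) => c b.
by case: ifP => _; rewrite ?mul1r ?mul0r ?mulr0 //; ring.
Qed.

Lemma ip_op_cm f g : ip mu f (op cm g)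
  = Z^-1 * \sum_(I : {set {set V}}) (q - 1) ^+ #|I|
      * ip (inactive_weight I) f (hbs p (enum (outside I)) g).
Proof.
rewrite -ip_sum_inactive mulr_sumr; apply: eq_bigr => A _.
rewrite -op_cm_inactive // /rc_measure -/(rcZ E p q).
by move: (rc_weight p q A) => c; ring.
Qed.

Lemma ip_rc_measure f g : ip mu f g
  = Z^-1 * \sum_(I : {set {set V}}) (q - 1) ^+ #|I| * ip (inactive_weight I) f g.
Proof.
rewrite -(ip_sum_inactive f (fun=> g)) mulr_sumr; apply: eq_bigr => A _.
under [X in f A * X]eq_bigr do rewrite -mulrA.
rewrite -mulr_suml sum_inactive /rc_measure rc_weightE -/(rcZ E p q).
by move: (_ ^+ #|_|) (bern p A) => c b; ring.
Qed.

Lemma cm_stochastic : stochastic cm.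
Proof.
have q0 : 0 <= q^-1 by rewrite invr_ge0 ltW // (q_gt0 q1).
have q1' : 0 <= 1 - q^-1 by rewrite subr_ge0 invf_le1 ?(ltW q1) // (q_gt0 q1).
have p1' : 0 <= 1 - p by rewrite subr_ge0 ltW.
split=> [A B|A].
  apply: sumr_ge0 => S _; rewrite !mulr_ge0 ?exprn_ge0 //.
  by apply: sumr_ge0 => D _; rewrite !mulr_ge0 ?exprn_ge0 // ltW.
have hbs1 (s : seq (edge E)) : hbs p s (fun=> 1) = (fun=> 1).
  elim: s => //= e s ->; apply: funext => B; rewrite /hb; ring.
have := op_cm p q (fun=> 1) A.
rewrite /op; under eq_bigr do rewrite mulr1; move=> ->.
under eq_bigr do rewrite hbs1 mulr1.
by rewrite sum_subset_binomial addrC subrK expr1n.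
Qed.

Lemma cm_reversible : reversible mu cm.
Proof.
move=> f g; rewrite (ipC _ (op _ _)) !ip_op_cm; congr (_ * _).
apply: eq_bigr => I _; congr (_ * _).
rewrite (hbs_sym f g (@inactive_weight_balanced I)); exact: ipC.
Qed.

Definition gd_rate e A : R := mu (e |: A) / (mu (e |: A) + mu (A :\ e)).

Lemma op_gd f A : op gd f A = m%:R^-1 * \sum_e hb e (gd_rate e) f A.
Proof.
rewrite /op /glauber_kernel; under eq_bigr do rewrite mulr_suml.
rewrite exchange_big mulr_sumr; apply: eq_bigr => e _ /=.
under [LHS]eq_bigr do rewrite -[_ * _ * f _]mulrA.
rewrite -mulr_sumr; congr (_ * _); rewrite /hb -/(gd_rate e A).
under eq_bigr do rewrite mulrDl.
rewrite big_split /=; congr (_ + _).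
  rewrite (bigD1 (e |: A)) //= eqxx mulr1 big1 ?addr0 // => B /negbTE ->.
  by rewrite mulr0 mul0r.
rewrite (bigD1 (A :\ e)) //= eqxx mulr1 big1 ?addr0 // => B /negbTE ->.
by rewrite mulr0 mul0r.
Qed.

Lemma gd_rate_blind e : blind e (gd_rate e).
Proof. by move=> A; rewrite /gd_rate !setE1. Qed.

Lemma gd_rate_balanced e : balanced mu e (gd_rate e).
Proof.
move=> A eA; rewrite /gd_rate setD1_id //; field.
by rewrite gt_eqF // addr_gt0.
Qed.

Lemma gd_rateE e A : e \notin A -> gd_rate e A
  = p * q ^+ #|comp (e |: A)| / (p * q ^+ #|comp (e |: A)| + (1 - p) * q ^+ #|comp A|).
Proof.
move=> eA; rewrite /gd_rate setD1_id // /rc_measure !rc_weightE -/(rcZ E p q).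
have := bern_setU1 p eA; have bA := b_gt0 A; have p1' : 0 < 1 - p by rewrite subr_gt0.
have := exprn_gt0 #|comp A| (q_gt0 q1); have := exprn_gt0 #|comp (e |: A)| (q_gt0 q1).
move: (q ^+ #|comp (e |: A)|) (q ^+ #|comp A|) => x y.
move: (bern p A) (bern p (e |: A)) bA => b b' b0 x0 y0 bE.
have {bE} -> : b' = b * p / (1 - p) by rewrite -bE mulfK // gt_eqF.
field; rewrite !gt_eqF // ?addr_gt0 ?mulr_gt0 //.
Qed.

Let comp_pow e A : 0 < q ^+ #|comp (e |: A)| <= q ^+ #|comp A|.
Proof.
rewrite exprn_gt0 ?(q_gt0 q1) // ler_weXn2l ?(ltW q1) //.
exact/card_components_anti/subsetUr.
Qed.

(** Adding an edge never increases the number of components, so with [q > 1] the cluster weight can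
    only penalise it. *)
Lemma gd_rate_le e A : gd_rate e A <= p.
Proof.
rewrite -(proj2 (gd_rate_blind e A)) gd_rateE ?setD11 //.
have /andP[] := comp_pow e (A :\ e).
move: (q ^+ #|comp (e |: A :\ e)|) (q ^+ #|comp (A :\ e)|)
  => x y x0 xy; have y0 := lt_le_trans x0 xy.
rewrite ler_pdivrMr ?addr_gt0 ?mulr_gt0 ?subr_gt0 // ler_pM2l //.
have : (1 - p) * x <= (1 - p) * y by rewrite ler_wpM2l // subr_ge0 ltW.
by lra.
Qed.

Lemma gd_rate_ge0 e A : 0 <= gd_rate e A.
Proof. by rewrite divr_ge0 ?addr_ge0. Qed.

(** The denominator in [gd_rateE] is at most [q ^+ #|comp A|]. The component count of [e |: A] is
    kept because it is the one produced by the Chayes-Machta side. *)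
Lemma gd_rate_ge e A : e \notin A ->
  p * q ^+ #|comp (e |: A)| <= q ^+ #|comp A| * gd_rate e A.
Proof.
move=> eA; rewrite gd_rateE //; have /andP[] := comp_pow e A.
move: (q ^+ #|comp (e |: A)|) (q ^+ #|comp A|) => x y x0 xy; have y0 := lt_le_trans x0 xy.
rewrite mulrA ler_pdivlMr ?addr_gt0 ?mulr_gt0 ?subr_gt0 // mulrC.
rewrite ler_pM2r ?mulr_gt0 //.
have : p * x <= p * y by rewrite ler_wpM2l // ltW.
by lra.
Qed.

Lemma gd_stochastic : stochastic gd.
Proof.
have r1 e A : 0 <= 1 - gd_rate e A.
  by rewrite subr_ge0 (le_trans (gd_rate_le e A)) ?ltW.
split=> [A B|A].
  apply: sumr_ge0 => e _; rewrite mulr_ge0 ?invr_ge0 //= -/(gd_rate e A).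
  by rewrite addr_ge0 // mulr_ge0 ?gd_rate_ge0.
have := op_gd (fun=> 1) A; rewrite /op; under eq_bigr do rewrite mulr1.
move=> ->; under eq_bigr do rewrite /hb !mulr1 addrC subrK.
by rewrite sumr_const mulVf // pnatr_eq0 -lt0n.
Qed.

Lemma ip_op_gd f g : ip mu f (op gd g)
  = m%:R^-1 * \sum_e ip mu f (hb e (gd_rate e) g).
Proof.
by rewrite -ip_sumr -ipZr; congr ip; apply: funext => A; rewrite op_gd.
Qed.

Lemma gd_reversible : reversible mu gd.
Proof.
move=> f g; rewrite (ipC _ (op _ _)) !ip_op_gd; congr (_ * _).
apply: eq_bigr => e _; rewrite [RHS]ipC.
exact: (hb_sym f g (@gd_rate_blind e) (@gd_rate_balanced e)).
Qed.

Lemma gd_energy f : m%:R * ip mu f (f \- op gd f)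
  = \sum_e \sum_(A : {set edge E} | e \notin A)
      mu A * gd_rate e A * (f (e |: A) - f A) ^+ 2.
Proof.
rewrite ipBr ip_op_gd mulrBr mulVKf ?pnatr_eq0 -?lt0n //.
rewrite mulr_natl -sumr_const -sumrB; apply: eq_bigr => e _.
by rewrite -ipBr hb_energy //; [exact: gd_rate_blind | exact: gd_rate_balanced].
Qed.

(** After [efron_stein], a pair [(e, A)] collects the sets [I] of components of [A] whose blocks
    avoid [e]. These are also sets of components of [e |: A], so their total weight is at most
    [q ^+ #|comp (e |: A)|], which [gd_rate_ge] compares with the Glauber rate. *)
Lemma cm_energy_le f : ip mu f (f \- op cm f)
  <= m%:R * ip mu f (f \- op gd f).
Proof.
rewrite gd_energy ipBr ip_op_cm ip_rc_measure -mulrBr -sumrB.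
rewrite ler_pdivrMl // mulr_sumr.
pose edge_sum I e := \sum_(A : {set edge E} | e \notin A)
  inactive_weight I A * p * (f (e |: A) - f A) ^+ 2.
apply: (@le_trans _ _ (\sum_(I : {set {set V}}) \sum_(e in outside I)
    (q - 1) ^+ #|I| * edge_sum I e)).
  apply: ler_sum => I _; rewrite -mulrBr -mulr_sumr.
  rewrite ler_wpM2l ?exprn_ge0 ?subr_ge0 ?(ltW q1) // -ipBr.
  have wb := @inactive_weight_balanced I.
  apply: le_trans (efron_stein f (inactive_weight_ge0 I) wb) _.
  rewrite big_enum /=; apply: ler_sum => e eF.
  by rewrite hb_energy //; apply: wb; rewrite mem_enum.
under eq_bigr do rewrite big_mkcond.
rewrite exchange_big; apply: ler_sum => e _.
under eq_bigr do rewrite -mulrb; rewrite /edge_sum.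
rewrite mulr_sumr.
apply: (@le_trans _ _ (\sum_(A : {set edge E} | e \notin A)
    bern p A * (p * q ^+ #|comp (e |: A)|) * (f (e |: A) - f A) ^+ 2)); last first.
  apply: ler_sum => A eA; move: (_ ^+ 2) (sqr_ge0 (f (e |: A) - f A)) => d d0.
  have -> : Z * (mu A * gd_rate e A * d)
      = bern p A * (q ^+ #|comp A| * gd_rate e A) * d.
    rewrite /rc_measure rc_weightE -/(rcZ E p q).
    move: (bern p A) (gd_rate e A) (q ^+ #|comp A|) => b r c.
    by field; rewrite gt_eqF.
  by rewrite ler_wpM2r // ler_wpM2l ?(ltW (b_gt0 A)) ?gd_rate_ge.
apply: (@le_trans _ _ (\sum_(A : {set edge E} | e \notin A)
   \sum_(I : {set {set V}} | e \in outside I) (q - 1) ^+ #|I|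
     * (inactive_weight I A * p * (f (e |: A) - f A) ^+ 2))).
  rewrite exchange_big [leRHS]big_mkcond; apply: ler_sum => I _.
  by case: (e \in _); rewrite ?mulr1n ?mulr_sumr.
apply: ler_sum => A eA.
rewrite -sum_inactive !mulr_sumr mulr_suml big_mkcond [leRHS]big_mkcond.
apply: ler_sum => I _.
have c0 : 0 <= bern p A * (p * (q - 1) ^+ #|I|) * (f (e |: A) - f A) ^+ 2.
  rewrite mulr_ge0 ?sqr_ge0 // mulr_ge0 ?(ltW (b_gt0 A)) //.
  by rewrite mulr_ge0 ?(ltW p0) // exprn_ge0 // subr_ge0 ltW.
case: ifP => eF; last by case: ifP.
rewrite sub_components_setU1 // /inactive_weight; case: ifP => _.
  rewrite mul1r le_eqVlt; apply/orP; left; apply/eqP.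
  by move: (bern p A) (_ ^+ #|I|) => b c; ring.
by rewrite !mul0r mulr0.
Qed.

(** Each update [Q_e] is a projection, so [<f, P f>] is the average of the squared norms of [Q_e f];
    the claim is convexity of the square. *)
Lemma gd_contraction f : ip mu (op gd f) (op gd f) <= ip mu f (op gd f).
Proof.
have -> : ip mu f (op gd f)
    = \sum_(A : {set edge E}) mu A * (m%:R^-1 * \sum_e hb e (gd_rate e) f A ^+ 2).
  rewrite ip_op_gd.
  under eq_bigr => e _.
    rewrite -hb_idem; last exact: gd_rate_blind.
    rewrite hb_sym; [|exact: gd_rate_blind|exact: gd_rate_balanced].
    over.
  rewrite exchange_big /= mulr_sumr; apply: eq_bigr => A _.
  rewrite [RHS]mulrCA [in RHS]mulr_sumr; congr (_ * _).
  by apply: eq_bigr => e _; rewrite expr2 mulrA.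
by apply: ler_sum => A _; rewrite -mulrA -expr2 op_gd ler_wpM2l ?mean_sqr_le.
Qed.

End Comparison.

(** * Burn-in and mixing of the Glauber dynamics *)

Section BurnIn.
Variables (R : realType) (V : finType) (E : {set {set V}}) (p q : R).
Hypotheses (p0 : 0 < p) (p1 : p < 1) (q1 : 1 < q) (E0 : (0 < #|{: edge E}|)%N).
Implicit Types (A B D F U : {set edge E}) (e : edge E).
Implicit Types (f g h : {set edge E} -> R).

Local Notation mu := (@rc_measure R V E p q).
Local Notation cm := (@cm_kernel R V E p q).
Local Notation gd := (@glauber_kernel R V E p q).
Local Notation m := #|{: edge E}|.

(* Bounds the probability that a sequence of updates of exactly the edges of U
   leads from B to A. *)
Definition refreshed U A B : R := (B :\: U == A :\: U)%:R * p ^+ #|A :&: U|.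

Lemma refreshed_ge0 U A B : 0 <= refreshed U A B.
Proof. by rewrite mulr_ge0 ?exprn_ge0 // ltW. Qed.

(** If [e] is in [U], its present state is overwritten later. Otherwise it must now take its value
    in [A], at a cost of at most [p] if present there and at most 1 if absent. *)
Lemma hb_refreshed_le U A e B :
  hb e (gd_rate p q e) (refreshed U A) B <= refreshed (e |: U) A B.
Proof.
have r0 := gd_rate_ge0 p0 p1 q1 e B; have rp := gd_rate_le p0 p1 q1 e B.
have r1 : 1 - gd_rate p q e B <= 1 by rewrite gerBl.
have r1' : 0 <= 1 - gd_rate p q e B by rewrite subr_ge0 (le_trans rp) ?ltW.
rewrite /hb /refreshed; have [eU|eU] := boolP (e \in U).
  have -> : (e |: B) :\: U = B :\: U.
    by apply/setP => x; rewrite !inE; case: eqP => // ->; rewrite eU.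
  have -> : (B :\ e) :\: U = B :\: U.
    by apply/setP => x; rewrite !inE; case: eqP => // ->; rewrite eU.
  by rewrite (setUidPr _) ?sub1set // -mulrDl addrC subrK mul1r.
have sub D : (D :\: U == A :\: U) -> (D :\ e = B :\ e) ->
    (B :\: (e |: U) == A :\: (e |: U)).
  move=> /eqP DA De; rewrite setUC -!setDDl -DA setDDl setUC -setDDl -De.
  by rewrite setDDl setUC -setDDl.
have [eA|eA] := boolP (e \in A).
  have -> : ((B :\ e) :\: U == A :\: U) = false.
    apply/negP => /eqP/setP/(_ e); rewrite !inE eqxx eA (negbTE eU).
    by rewrite andbF.
  rewrite mul0r mulr0 addr0.
  have -> : #|A :&: (e |: U)| = #|A :&: U|.+1.
    rewrite setIUr (setIidPr _) ?sub1set // cardsU1 inE (negbTE eU) andbF //.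
  case: (boolP ((e |: B) :\: U == A :\: U)) => [BA|_]; last first.
    by rewrite mul0r mulr0 mulr_ge0 ?exprn_ge0 // ltW.
  by rewrite (sub _ BA) ?setD1U1 // !mul1r exprS ler_wpM2r // exprn_ge0 // ltW.
have -> : ((e |: B) :\: U == A :\: U) = false.
  by apply/negP => /eqP/setP/(_ e); rewrite !inE eqxx (negbTE eA) eU.
rewrite mul0r mulr0 add0r.
have -> : A :&: (e |: U) = A :&: U.
  by apply/setP => x; rewrite !inE; case: eqP => // ->; rewrite (negbTE eA).
rewrite mulrA ler_wpM2r ?exprn_ge0 ?(ltW p0) //.
case: (boolP ((B :\ e) :\: U == A :\: U)) => [BA|_]; last by rewrite mulr0.
by rewrite (sub _ BA) ?setD1D1 // mulr1.
Qed.

Lemma op_gd_refreshed_le U A B :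
  op gd (refreshed U A) B <= \sum_e m%:R^-1 * refreshed (e |: U) A B.
Proof.
rewrite op_gd mulr_sumr; apply: ler_sum => e _.
by rewrite ler_wpM2l ?invr_ge0 // hb_refreshed_le.
Qed.

Lemma refreshed_mass U B : \sum_(A : {set edge E}) refreshed U A B <= (1 + p) ^+ m.
Proof.
rewrite -[leLHS](_ : \sum_(A : {set edge E} | A :\: U == B :\: U) p ^+ #|A :&: U| = _).
  rewrite (reindex_onto (fun D => (B :\: U) :|: D) (fun A => A :&: U)) /=; last first.
    by move=> A /eqP <-; rewrite setUC setID.
  apply: (@le_trans _ _ ((1 + p) ^+ #|U|)); last first.
    by rewrite ler_weXn2l ?max_card // lerDl ltW.
  rewrite addrC -sum_subset_binomial [leLHS]big_mkcond [leRHS]big_mkcond.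
  apply: ler_sum => D _; rewrite expr1n mulr1.
  have -> : (B :\: U :|: D) :&: U = D :&: U.
    by rewrite setIUl setIDAC setDIl setDv setI0 set0U.
  have [DU|/negP nDU] := boolP (D \subset U).
    by rewrite (setIidPl DU); case: ifP => // _; rewrite exprn_ge0 // ltW.
  by case: ifP => // /andP[_ /eqP/setIidPl].
rewrite big_mkcond; apply: eq_bigr => A _; rewrite /refreshed eq_sym.
by case: eqP; rewrite ?mul1r ?mul0r.
Qed.

(** A coupon collector argument: [#|~: U|] counts the edges not yet updated, and its mean shrinks by
    [1 - 1/m] per step. Once all are collected, [A] has weight [p ^+ #|A|]; failing that, the crude
    bound [refreshed_mass] is charged. *)
Lemma iter_gd_refreshed_le h (H : R) t U B :
  (forall A, 0 <= h A <= H) ->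
  \sum_(A : {set edge E}) h A * iter t (op gd) (refreshed U A) B
  <= \sum_(A : {set edge E}) h A * p ^+ #|A|
     + #|~: U|%:R * (H * (1 + p) ^+ m * (1 - m%:R^-1) ^+ t).
Proof.
move=> hH; have h0 A : 0 <= h A by case/andP: (hH A).
have sG := gd_stochastic p0 p1 q1 E0.
have m0 : 0 < m%:R :> R by rewrite ltr0n.
have H0 : 0 <= H by case/andP: (hH set0) => /le_trans; apply.
have L0 : 0 <= H * (1 + p) ^+ m by rewrite mulr_ge0 // exprn_ge0 // addr_ge0 ?(ltW p0).
elim: t U => [|t IH] U.
  rewrite expr0 mulr1 /=; have [UT|UN] := eqVneq (~: U) set0.
    rewrite UT cards0 mul0r addr0; apply: ler_sum => A _.
    rewrite ler_wpM2l // /refreshed -[U]setCK UT setC0 setIT.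
    by case: eqP; rewrite ?mul1r // mul0r exprn_ge0 // ltW.
  apply: ler_wpDl; first by apply: sumr_ge0 => A _; rewrite mulr_ge0 // exprn_ge0 // ltW.
  apply: (@le_trans _ _ (H * \sum_(A : {set edge E}) refreshed U A B)).
    rewrite mulr_sumr; apply: ler_sum => A _.
    by rewrite ler_wpM2r ?refreshed_ge0 //; case/andP: (hH A).
  apply: le_trans (ler_wpM2l H0 (refreshed_mass U B)) _.
  (* At least one edge is missing, so the factor [#|~: U|] is at least 1. *)
  by rewrite -[leLHS]mul1r ler_wpM2r // ler1n card_gt0.
set S := \sum_A _ in IH *; set L := H * _ in IH L0 *.
apply: (@le_trans _ _ (\sum_e m%:R^-1 * \sum_(A : {set edge E})
    h A * iter t (op gd) (refreshed (e |: U) A) B)).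
  under [leRHS]eq_bigr do rewrite mulr_sumr.
  rewrite exchange_big; apply: ler_sum => A _ /=.
  (* [U] grows backwards in time: the innermost application is the last update not yet accounted
     for. *)
  rewrite -iterS iterSr.
  apply: (@le_trans _ _ (h A * (\sum_e m%:R^-1 * iter t (op gd) (refreshed (e |: U) A) B))).
    rewrite ler_wpM2l // -iter_op_sum.
    by apply: le_iter_op => // D; apply: op_gd_refreshed_le.
  rewrite mulr_sumr; apply: ler_sum => e _.
  by rewrite mulrCA.
apply: (@le_trans _ _ (\sum_e m%:R^-1 * (S + #|~: (e |: U)|%:R * (L * (1 - m%:R^-1) ^+ t)))).
  by apply: ler_sum => e _; rewrite ler_wpM2l ?invr_ge0.
rewrite -mulr_sumr big_split /= sumr_const -mulr_suml.
(* Each missing edge stays missing for [m - 1] of the [m] choices of [e]. *)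
have -> : \sum_(e : edge E) #|~: (e |: U)|%:R = #|~: U|%:R * (m%:R - 1) :> R.
  have cardE e : #|~: (e |: U)|%:R = #|~: U|%:R - (e \in ~: U)%:R :> R.
    rewrite (cardsD1 e (~: U)) natrD addrAC subrr add0r; congr (_%:R).
    by rewrite setUC setCU setDE.
  under eq_bigr do rewrite cardE.
  rewrite sumrB sumr_const [RHS]mulrBr mulr1 mulr_natr; congr (_ - _).
  rewrite -sum1_card natr_sum [RHS]big_mkcond; apply: eq_bigr => e _.
  by case: (e \in _).
rewrite -(mulr_natr S) exprS le_eqVlt; apply/orP; left; apply/eqP.
rewrite -[#|xpredT|]/m; move: (_ ^+ t) => a; move: (#|~: U|%:R : R) => b.
move: (m%:R : R) m0 => c c0; field.
by rewrite gt_eqF.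
Qed.

Lemma iter_gd_burn_in h (H : R) t B : (forall A, 0 <= h A <= H) ->
  iter t (op gd) h B <= \sum_(A : {set edge E}) h A * p ^+ #|A|
     + m%:R * (H * (1 + p) ^+ m * (1 - m%:R^-1) ^+ t).
Proof.
move=> hH; have := iter_gd_refreshed_le t set0 B hH.
rewrite setC0 cardsT; apply: le_trans; rewrite -iter_op_sum.
have {1}-> : h = fun y => \sum_(A : {set edge E}) h A * refreshed set0 A y; last by [].
apply: funext => D; rewrite (bigD1 D) //= big1 => [|A AD].
  by rewrite /refreshed !setD0 eqxx setI0 cards0 !mulr1 addr0.
by rewrite /refreshed !setD0 eq_sym (negbTE AD) mul0r mulr0.
Qed.

Definition density_bound : R := q ^+ #|V| / (1 - p) ^+ #|E|.

Lemma density_le A : p ^+ #|A| <= density_bound * mu A.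
Proof.
have p1' : 0 < 1 - p by rewrite subr_gt0.
have q0 := q_gt0 q1; have Z0 := rcZ_gt0 E p0 p1 q1.
have ZV := rcZ_le E p0 p1 q1; rewrite /density_bound /rc_measure -/(rcZ E p q).
have bA := bern_gt0 p0 p1 A.
have wA : p ^+ #|A| * (1 - p) ^+ #|E| <= rc_weight p q A.
  apply: (@le_trans _ _ (bern p A)).
    rewrite /bern ler_wpM2l ?exprn_ge0 ?(ltW p0) //.
    by rewrite ler_wiXn2l ?leq_subr ?(ltW p1') // gerBl ltW.
  by rewrite rc_weightE ler_peMr ?(ltW bA) // exprn_ege1 // ltW.
have w0 := rc_weight_gt0 p0 p1 q1 A; have b0 := exprn_gt0 #|E| p1'.
move: (rc_weight p q A) (p ^+ #|A|) w0 wA => w a w0 wA.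
move: (rcZ E p q) (q ^+ #|V|) ((1 - p) ^+ #|E|) Z0 b0 ZV wA => z c b z0 b0 zc wb.
apply: (@le_trans _ _ (w / b)); first by rewrite ler_pdivlMr.
have -> : c / b * (w / z) = (w / b) * (c / z) by ring.
by rewrite ler_peMr ?divr_ge0 ?(ltW w0) ?(ltW b0) // ler_pdivlMr // mul1r.
Qed.

(** The test function is bounded by 2 after centring. Hence [8 = 2 * 4] makes the burn-in error at
    most 1/4, and [64 = 2^2 * 4^2] does the same for the relaxation error through its square. The
    factor 1/2 in [tv_dist] turns their sum into 1/4. *)
Lemma gd_mixed T s t : (0 < T)%N ->
  (forall A, tv_dist (law_at cm T A) mu <= 4^-1) ->
  8 * m%:R * (1 + p) ^+ m * (1 - m%:R^-1) ^+ t <= 1 ->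
  64 * density_bound ^+ 2 * (1 - (3 * T%:R * m%:R)^-1) ^+ s <= 1 ->
  forall B, tv_dist (law_at gd (t + s) B) mu <= 4^-1.
Proof.
move=> T0 mix small_t small_s B.
have mu0 A : 0 <= mu A by exact/ltW/rc_measure_gt0.
have mu1 : \sum_A mu A = 1 by exact: rc_measure_sum1.
have sG := gd_stochastic p0 p1 q1 E0.
have rG : reversible mu gd by apply: gd_reversible.
have sC : stochastic cm by apply: cm_stochastic.
have rC : reversible mu cm by apply: cm_reversible.
have [mR mRE] : exists r : R, r = m%:R by exists m%:R.
have [L LE] : exists r : R, r = (1 + p) ^+ m by exists ((1 + p) ^+ m).
rewrite -?LE -!mRE in small_t small_s; have m1 : 1 <= mR by rewrite mRE ler1n.
have T1 : 1 <= T%:R :> R by rewrite ler1n.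
(* The constant 8/3 of [poincare_of_mixing] is rounded up to 3; [mR] is the loss in
   [cm_energy_le]. *)
pose k : R := 3 * T%:R * mR.
have k1 : 1 <= k by rewrite !mulr_ege1 // ler1n.
have gap g : ip mu (fun=> 1) g = 0 -> ip mu g g <= k * ip mu g (g \- op gd g).
  move=> g0; have := poincare_of_mixing mu0 mu1 sC rC mix g0.
  have := ler_wpM2l (ler0n R T) (cm_energy_le p0 p1 q1 E0 g).
  have := ip_ge0 g mu0; rewrite /k -mRE -!mulrA.
  move: (ip mu g g) (ip mu g (g \- op gd g)) (ip mu g (g \- op cm g)) => x a b.
  move: (T%:R * (mR * a)) (T%:R * b) => y z; clear mRE LE; lra.
(* The sign of the error is the test function that attains the [l1] distance. *)
pose f A := Num.sg (law_at gd (t + s) B A - mu A).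
pose c := ip mu (fun=> 1) f.
have c1 : `|c| <= 1.
  apply: le_trans (ler_norm_sum _ _ _) _; rewrite -[leRHS]mu1; apply: ler_sum => A _.
  by rewrite mulr1 normrM ger0_norm // ler_piMr // normr_sg lern1 leq_b1.
pose fb := f \- (fun=> c).
have fb0 : ip mu (fun=> 1) fb = 0.
  rewrite /fb ipBr -/c /ip; under eq_bigr do rewrite mulr1.
  by rewrite -mulr_suml mu1 mul1r subrr.
have fb2 A : `|fb A| <= 2.
  have f1 : `|f A| <= 1 by rewrite /f normr_sg lern1 leq_b1.
  apply: le_trans (ler_normB _ _) _; clear mRE LE; lra.
pose g := iter s (op gd) fb.
have g2 A : 0 <= `|g A| <= 2.
  rewrite normr_ge0 /=; apply: le_trans (norm_iter_op _ _ _ sG) _.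
  by have := @le_iter_op _ _ _ _ (fun=> 2) s A sG fb2; rewrite iter_op_cst.
have sumE : \sum_A `|law_at gd (t + s) B A - mu A| = iter t (op gd) g B.
  rewrite /g -iterD /fb iter_opB iter_op_cst //= -op_law_at /c /ip -sumrB.
  by apply: eq_bigr => A _; rewrite mulr1 -mulrBl mulrC -normrEsg.
have l1 : ip mu (fun=> 1) (fun A => `|g A|) ^+ 2 * (16 * density_bound ^+ 2) <= 1.
  apply: le_trans small_s; have d0 : 0 <= density_bound ^+ 2 by exact: sqr_ge0.
  have cs := ip_cauchy_schwarz (fun=> 1) (fun A => `|g A|) mu0.
  have decay : ip mu g g <= (1 - k^-1) ^+ s * 4.
    have dec : ip mu g g <= (1 - k^-1) ^+ s * ip mu fb fb.
      by apply: ip_iter_op_decay => // h; apply: gd_contraction.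
    apply: (le_trans dec); rewrite ler_wpM2l ?exprn_ge0 ?subr_ge0 ?invf_le1 ?(lt_le_trans ltr01) //.
    rewrite -[leRHS]mul1r -[X in X * 4]mu1 mulr_suml; apply: ler_sum => A _.
    rewrite -mulrA ler_wpM2l // -expr2 -(real_normK (num_real _)).
    by rewrite (_ : 4 = 2 ^+ 2) ?lerXn2r ?nnegrE //; clear mRE LE; lra.
  have e1 : ip mu (fun=> 1) (fun=> 1) = 1.
    by rewrite /ip; under eq_bigr do rewrite !mulr1.
  have e2 : ip mu (fun A => `|g A|) (fun A => `|g A|) = ip mu g g.
    rewrite /ip; apply: eq_bigr => A _.
    by rewrite -!mulrA -!expr2 real_normK ?num_real.
  rewrite e1 mul1r e2 in cs; have := le_trans cs decay.
  move/(ler_wpM2r d0); rewrite -/k; clear mRE LE; lra.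
rewrite /tv_dist sumE.
have /le_trans : iter t (op gd) g B <= iter t (op gd) (fun A => `|g A|) B.
  by apply: le_iter_op => // A; apply: ler_norm.
move=> /(_ _ (iter_gd_burn_in t B g2)) burn.
have : \sum_(A : {set edge E}) `|g A| * p ^+ #|A|
    <= density_bound * ip mu (fun=> 1) (fun A => `|g A|).
  rewrite mulr_sumr; apply: ler_sum => A _; rewrite mulr1 mulrA [leRHS]mulrC.
  by rewrite ler_wpM2l // density_le.
have D0 : 0 <= density_bound.
  by rewrite divr_ge0 ?exprn_ge0 ?subr_ge0 ?(ltW p1) // ltW // q_gt0.
have : density_bound * ip mu (fun=> 1) (fun A => `|g A|) <= 4^-1.
  set y := ip mu _ _ in l1 *.
  have : (density_bound * y) ^+ 2 <= 4^-1 ^+ 2 by rewrite exprMn; clear mRE LE burn; lra.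
  have y0 : 0 <= y by apply: sumr_ge0 => A _; rewrite mulr1 mulr_ge0.
  by rewrite ler_sqr ?nnegrE ?invr_ge0 // mulr_ge0.
move: burn small_t; rewrite -LE -mRE -!mulrA.
move: (L * _) (_ * ip mu _ _) (\sum_A _) => x y z; clear mRE LE; lra.
Qed.

End BurnIn.

(* Imported late, as classical_sets shadows names of finset. *)
From mathcomp Require Import classical_sets filter ereal topology sequences exp.
Local Open Scope classical_set_scope.

(** * Mixing times as extended reals *)

Section MixingTime.
Variables (R : realType) (T : finType) (P : T -> T -> R) (w : T -> R).

Lemma mixing_time_ge0 : (0 <= mixing_time P w)%E.
Proof. exact: bigmax_ge_id. Qed.

Lemma mixing_time_le (N : nat) :
  (forall x, tv_dist (law_at P N x) w <= 4^-1) ->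
  (mixing_time P w <= N%:R%:E)%E.
Proof.
move=> mix; apply/bigmax_leP; split=> [|x _]; first by rewrite lee_fin.
rewrite /min_time; case: pselect => [ex|[]]; last by exists N.
by rewrite lee_fin ler_nat; case: ex_minnP => t _; apply.
Qed.

(** A start that never mixes gives [+oo]. Otherwise the largest of the first mixing times serves all
    starts at once, by [tv_dist_anti]. *)
Lemma mixing_time_finite (x0 : T) : stochastic P -> reversible w P ->
  mixing_time P w = +oo%E \/ exists2 N : nat,
    forall x, tv_dist (law_at P N x) w <= 4^-1 & (N%:R%:E <= mixing_time P w)%E.
Proof.
move=> sP rP; pose mixed x t := tv_dist (law_at P t x) w <= 4^-1.
have le_mix x : (min_time R (mixed x) <= mixing_time P w)%E by exact: le_bigmax.
have [allx|/existsNP[x nx]] := pselect (forall x, exists t, mixed x t); last first.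
  left; apply/eqP; rewrite -leye_eq; apply: le_trans (le_mix x).
  by rewrite /min_time; case: pselect.
right; have minE x : min_time R (mixed x) = (ex_minn (allx x))%:R%:E.
  rewrite /min_time; case: pselect => // ex; congr (_%:R%:E).
  apply/eqP; rewrite eqn_leq; case: ex_minnP => a pa ma.
  by case: ex_minnP => b pb mb; rewrite ma ?mb.
have T0 : (0 < #|T|)%N by apply/card_gt0P; exists x0.
have [y yE] := @bigop.eq_bigmax _ (fun x => ex_minn (allx x)) T0.
exists (\max_x ex_minn (allx x))%N => [x|]; last by rewrite yE -minE.
apply: le_trans (tv_dist_anti sP rP x (leq_bigmax x)) _.
by case: ex_minnP.
Qed.

End MixingTime.

(** * Numerical estimates of the running times *)

Section Estimates.
Variable R : realType.
Implicit Types (x y p q K : R) (n m t : nat).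

Lemma le_expRn n : n%:R <= expR n%:R :> R.
Proof. by apply: le_trans (expR_ge1Dx _); rewrite lerDr. Qed.

Lemma expR_ge_pow2 k n : (0 < n)%N -> 2 ^+ k <= expR (k%:R * n%:R) :> R.
Proof.
move=> n0; rewrite expRM_natl lerXn2r ?nnegrE ?expR_ge0 //.
apply: le_trans (expR_ge1Dx _); rewrite (_ : 2 = 1 + 1) // lerD2l.
by rewrite ler1n.
Qed.

Lemma decay_le (k : R) m t : 1 <= k -> t%:R = k * m%:R ->
  (1 - k^-1) ^+ t <= expR (- m%:R).
Proof.
move=> k1 tE; have k0 : 0 < k by apply: lt_le_trans k1.
apply: (@le_trans _ _ (expR (- k^-1) ^+ t)).
  rewrite lerXn2r ?nnegrE ?expR_ge0 ?expR_ge1Dx //.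
  by rewrite subr_ge0 invf_le1.
by rewrite -expRM_natl tE mulrN mulrAC divff ?mul1r // gt_eqF.
Qed.

Lemma pow_1Dp_le p K n m : 0 <= p -> p * n%:R <= K -> (m <= n ^ 2)%N ->
  (1 + p) ^+ m <= expR (K * n%:R).
Proof.
move=> p0 pnK mn; apply: (@le_trans _ _ (expR p ^+ m)).
  by rewrite lerXn2r ?nnegrE ?expR_ge0 ?expR_ge1Dx // addr_ge0.
rewrite -expRM_natl ler_expR.
apply: (@le_trans _ _ (n%:R ^+ 2 * p)).
  by rewrite ler_wpM2r // -natrX ler_nat.
by rewrite expr2 -mulrA mulrC [n%:R * p]mulrC ler_wpM2r.
Qed.

(** The factors are at most [e^(3n)], [e^(2n)] and [e^(Kn)], which gives [K + 5]; the decay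
    contributes [e^(-nc)]. *)
Lemma burn_in_time p K n m c : 0 <= p -> p * n%:R <= K -> (0 < n)%N ->
  (0 < m <= n ^ 2)%N -> K + 5 <= c%:R ->
  8 * m%:R * (1 + p) ^+ m * (1 - m%:R^-1) ^+ (m * (n * c)) <= 1.
Proof.
move=> p0 pnK n0 /andP[m0 mn] Kc.
have h1 : 8 <= expR (3%:R * n%:R) :> R.
  by apply: le_trans (expR_ge_pow2 3 n0); rewrite -natrX.
have h2 : m%:R <= expR (2%:R * n%:R) :> R.
  apply: (@le_trans _ _ (n%:R ^+ 2)); first by rewrite -natrX ler_nat.
  by rewrite expRM_natl lerXn2r ?nnegrE ?expR_ge0 // le_expRn.
have h3 := pow_1Dp_le p0 pnK mn.
have h4 : (1 - m%:R^-1) ^+ (m * (n * c)) <= expR (- (n * c)%:R) :> R.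
  by apply: decay_le; rewrite ?ler1n ?natrM.
apply: (@le_trans _ _ (expR (3%:R * n%:R) * expR (2%:R * n%:R)
  * expR (K * n%:R) * expR (- (n * c)%:R))).
  by rewrite !ler_pM ?mulr_ge0 ?exprn_ge0 ?subr_ge0 ?invf_le1 ?ltr0n ?ler1n ?addr_ge0.
rewrite -!expRD -[leRHS]expR0 ler_expR natrM.
have := ler_wpM2l (ler0n R n) Kc; lra.
Qed.

(** Here 64 is at most [e^(6n)] and the density factor at most [e^((ln q + 2K)n)] before squaring;
    [2K] comes from [1/(1 - p) <= 1 + 2p], valid for [p <= 1/2]. *)
Lemma decay_time p q K n m c (k : nat) : 0 < p -> p <= 2^-1 -> p * n%:R <= K ->
  1 < q -> (0 < n)%N -> (0 < k)%N -> (m <= n ^ 2)%N ->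
  6 + 2 * ln q + 4 * K <= c%:R ->
  64 * (q ^+ n / (1 - p) ^+ m) ^+ 2 * (1 - k%:R^-1) ^+ (k * (n * c)) <= 1.
Proof.
move=> p0 p2 pnK q1 n0 k0 mn Kc.
have p1 : 0 < 1 - p by lra.
have h1 : 64 <= expR (6%:R * n%:R) :> R.
  by apply: le_trans (expR_ge_pow2 6 n0); rewrite -natrX.
have h2 : q ^+ n / (1 - p) ^+ m <= expR (ln q * n%:R + 2 * K * n%:R).
  rewrite expRD; apply: ler_pM; rewrite ?exprn_ge0 ?invr_ge0 ?exprn_ge0 ?(ltW p1) //.
  - by rewrite (le_trans _ (ltW q1)).
  - by rewrite mulrC expRM_natl lnK // posrE (lt_trans _ q1).
  rewrite -exprVn; apply: le_trans (_ : (1 + 2 * p) ^+ m <= _).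
    rewrite lerXn2r ?nnegrE ?invr_ge0 ?(ltW p1) //; first by lra.
    rewrite -[leLHS]mul1r ler_pdivrMr //.
    have : p * p <= 2^-1 * p by rewrite ler_wpM2r // ltW.
    by lra.
  by apply: pow_1Dp_le; rewrite ?mulr_ge0 ?(ltW p0) // -mulrA ler_wpM2l.
have h4 : (1 - k%:R^-1) ^+ (k * (n * c)) <= expR (- (n * c)%:R) :> R.
  by apply: decay_le; rewrite ?ler1n ?natrM.
apply: (@le_trans _ _ (expR (6%:R * n%:R)
  * expR (ln q * n%:R + 2 * K * n%:R) ^+ 2 * expR (- (n * c)%:R))).
  have D0 : 0 <= q ^+ n / (1 - p) ^+ m.
    by rewrite divr_ge0 ?exprn_ge0 ?(ltW p1) // (le_trans _ (ltW q1)).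
  move: (q ^+ n / _) D0 h2 => D D0 h2.
  rewrite ler_pM ?mulr_ge0 ?sqr_ge0 ?exprn_ge0 ?subr_ge0 ?invf_le1 ?ltr0n ?ler1n //.
  by rewrite ler_pM ?sqr_ge0 // lerXn2r ?nnegrE ?expR_ge0.
rewrite -expRM_natl -!expRD -[leRHS]expR0 ler_expR natrM.
have := ler_wpM2l (ler0n R n) Kc; lra.
Qed.

End Estimates.

Unset Implicit Arguments.

Theorem theorem1p2 (R : realType) (q K : R) (hq : 1 < q) :
  exists2 C : R, 0 < C &
    forall zeta : nat -> R,
      (forall n, 0 < zeta n) ->
      (\forall n \near \oo, zeta n <= K) ->
      \forall n \near \oo,
        (tau_GD n (zeta n / n%:R) q <=
           tau_CM n (zeta n / n%:R) q *
           (C * (n%:R ^+ 3 * ln n%:R ^+ 2))%:E)%E.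
Proof.
pose c0 := Num.bound (`|K| + 5); pose c1 := Num.bound `|6 + 2 * ln q + 4 * K|.
have c0K : K + 5 <= c0%:R.
  apply: le_trans (ltW (archi_boundP _)); last by rewrite addr_ge0.
  by rewrite lerD2r ler_norm.
have c1K : 6 + 2 * ln q + 4 * K <= c1%:R.
  by apply: le_trans (ler_norm _) (ltW (archi_boundP _)).
(* Burn-in takes at most [c0 * n^3] steps and relaxation at most [3 * c1 * T * n^3]; the successor
   makes the constant positive. *)
exists (c0 + 3 * c1).+1%:R; first by rewrite ltr0n.
move=> zeta zeta0 zetaK.
(* The 2 provides an edge, [2 * |K|] gives [p <= 1/2], and [expR 1] gives [ln n >= 1], so the
   logarithmic factor only enlarges the bound. *)
have large : \forall n \near \oo, (2 + Num.bound (2 * `|K| + expR 1) <= n)%N.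
  exact: nbhs_infty_ge.
apply: filterS2 zetaK large => n zK nbig.
have n2 : (1 < n)%N by apply: leq_trans nbig.
have n0 : (0 < n)%N by apply: ltnW.
have nR0 : 0 < n%:R :> R by rewrite ltr0n.
have nK : 2 * `|K| + expR 1 <= n%:R.
  apply: le_trans (ltW (archi_boundP _)) _.
    by rewrite addr_ge0 ?mulr_ge0 ?expR_ge0.
  by rewrite ler_nat (leq_trans _ nbig) // leq_addl.
have ln1 : 1 <= ln n%:R :> R.
  rewrite -[leLHS]expRK ler_ln ?posrE ?expR_gt0 //.
  by apply: le_trans nK; rewrite lerDr mulr_ge0.
set p := zeta n / n%:R.
have p0 : 0 < p by rewrite divr_gt0.
have pnK : p * n%:R <= K by rewrite divfK // gt_eqF.
have p2 : p <= 2^-1.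
  rewrite ler_pdivrMr // (le_trans zK) //.
  have := expR_ge0 (1 : R); have := ler_norm K; lra.
have p1 : p < 1 by lra.
pose m := #|complete_edges n|.
have mE : m = 'C(n, 2) by rewrite /m /complete_edges card_draws card_ord.
have m0 : (0 < m)%N by rewrite mE bin_gt0.
have mn : (m <= n ^ 2)%N.
  by rewrite mE bin2 -divn2 (leq_trans (leq_div _ _)) // expnS expn1 leq_mul2l leq_pred orbT.
have E0 : (0 < #|{: edge (complete_edges n)}|)%N by rewrite card_edge.
have logn : 1 <= ln n%:R ^+ 2 :> R by rewrite exprn_ege1.
have bound0 : 0 < (c0 + 3 * c1).+1%:R * (n%:R ^+ 3 * ln n%:R ^+ 2) :> R.
  by rewrite !mulr_gt0 ?exprn_gt0 ?ltr0n // (lt_le_trans ltr01).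
have sC : stochastic (@cm_kernel R _ (complete_edges n) p q).
  by apply: cm_stochastic.
have rC : reversible (@rc_measure R _ (complete_edges n) p q)
    (@cm_kernel R _ (complete_edges n) p q) by apply: cm_reversible.
have [tauoo|[T mixT leT]] := mixing_time_finite finset.set0 sC rC.
  by rewrite /tau_CM tauoo gt0_mulye ?lte_fin // leey.
(* At time 0 both chains have the same point masses and the same target, so mixing of one at time 0
   is mixing of the other; [gd_mixed] covers positive [T]. *)
have [T0|T0] := posnP T.
  apply: (@le_trans _ _ 0%E); last first.
    by rewrite mule_ge0 ?mixing_time_ge0 // lee_fin ltW.
  apply: (@mixing_time_le _ _ _ _ 0%N) => x.
  by have := mixT x; rewrite T0 /law_at !expr0.
pose k := (3 * T * m)%N.
have mixG : forall A, tv_dist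
    (law_at (@glauber_kernel R _ (complete_edges n) p q) (m * (n * c0) + k * (n * c1)) A)
    (@rc_measure R _ (complete_edges n) p q) <= 4^-1.
  apply: (gd_mixed p0 p1 hq E0 T0 mixT).
    rewrite card_edge; apply: (@burn_in_time _ _ K) => //; first exact: ltW.
    by rewrite m0.
  rewrite card_edge /density_bound card_ord -!natrM.
  by apply: (@decay_time _ _ _ K) => //; rewrite /k !muln_gt0 T0.
apply: le_trans (mixing_time_le mixG) _.
apply: (@le_trans _ _ (T%:R%:E * ((c0 + 3 * c1).+1%:R * (n%:R ^+ 3 * ln n%:R ^+ 2))%:E)%E).
  rewrite -EFinM lee_fin.
  apply: (@le_trans _ _ (T * ((c0 + 3 * c1) * n ^ 3))%N%:R).
    have -> : (T * ((c0 + 3 * c1) * n ^ 3)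
        = n ^ 2 * (n * c0 * T) + 3 * T * n ^ 2 * (n * c1))%N by ring.
    rewrite ler_nat /k leq_add //; first by rewrite leq_mul // leq_pmulr.
    by rewrite leq_mul // leq_mul.
  rewrite natrM ler_wpM2l // natrM natrX ler_pM ?mulr_ge0 //.
    by rewrite ler_nat.
  by rewrite ler_peMr ?exprn_ge0.
by rewrite lee_wpmul2r // lee_fin ltW.
Qed.
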